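(* Let $T_0$ be a self-adjoint operator on $\mathcal{H}$, let $s_n$ ($n\in\mathbb{N}$) be self-adjoint operators on $\mathcal{H}$ such that $s_n\to I$ strongly as $n\to\infty$ and $\|s_n\|\le C$ for some $C>0$ independent of $n$, let $\gamma>0$, and let $T_n=T_0+i\gamma s_n$ with $D(T_n)=D(T_0)$. (a) If $s_n$ is a projection operator, that is $s_n^2=s_n$, for all $n$, then $$\sigma_e((T_n))\cup\sigma_e((T_n^* ))^*\subset\Gamma_a:=\left\{\lambda\in\mathbb{C}:\ \mathrm{Im}(\lambda)\in[0,\gamma],\ \mathrm{dist}(\mathrm{Re}(\lambda),\sigma_e(T_0))\le\sqrt{\mathrm{Im}(\lambda)(\gamma-\mathrm{Im}(\lambda))}\right\}.$$ (b) Suppose that for every sequence $(u_n)\subset D(T_0)$ which is bounded in $\mathcal{H}$ and for which $(T_0u_n)$ is bounded in $\mathcal{H}$, one has $\langle s_nu_n,T_0u_n\rangle-\langle T_0u_n,s_nu_n\rangle\to0$ as $n\to\infty$. Then $$\sigma_e((T_n))\cup\sigma_e((T_n^* ))^*\subset\Gamma_b:=\sigma_e(T_0)\times i\gamma[s_-,s_+].$$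
   Context: $\mathcal{H}$ is a separable Hilbert space with inner product $\langle\cdot,\cdot\rangle$ and norm $\|\cdot\|$; $\rightharpoonup$ denotes weak convergence in $\mathcal{H}$. The essential spectrum of an operator $H$ on $\mathcal{H}$ is $\sigma_e(H)=\{\lambda\in\mathbb{C}:\exists (u_n)\subset D(H)\text{ with }\|u_n\|=1,\ u_n\rightharpoonup0,\ \|(H-\lambda)u_n\|\to0\}$. The limiting essential spectrum of a sequence $(H_n)$ of operators on $\mathcal{H}$ is $\sigma_e((H_n))=\{\lambda\in\mathbb{C}:\exists I\subset\mathbb{N}\text{ infinite},\ \exists u_n\in D(H_n),\ n\in I,\text{ with }\|u_n\|=1,\ u_n\rightharpoonup0,\ \|(H_n-\lambda)u_n\|\to0\}$ (limits along $n\in I$). For a set $A\subset\mathbb{C}$, $A^*$ is the set of complex conjugates of elements of $A$. Here $T_n^*=T_0-i\gamma s_n$. $s_-:=\liminf_{n\to\infty}\inf_{\|u\|=1}\langle s_nu,u\rangle$ and $s_+:=\limsup_{n\to\infty}\sup_{\|u\|=1}\langle s_nu,u\rangle$. For $A\subset\mathbb{R}$, $A\times i\gamma[s_-,s_+]$ denotes $\{a+i\gamma t: a\in A,\ t\in[s_-,s_+]\}\subset\mathbb{C}$. *)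

(* Defs.v *)
From HB Require Import structures.
From mathcomp Require Import all_boot all_order all_algebra.
From mathcomp Require Import sesquilinear complex.
From mathcomp Require Import all_classical all_reals all_analysis.

Set Implicit Arguments.
Unset Strict Implicit.
Unset Printing Implicit Defensive.

Import Order.TTheory GRing.Theory Num.Theory.
Import numFieldNormedType.Exports.

Local Open Scope classical_set_scope.
Local Open Scope ring_scope.

(* The usual topology of the complex numbers [R[i]], as a normed module over
   itself.  The norm of [R[i]], and of every normed module over it, takes its
   values in [R[i]]; these values are nonnegative reals. *)
HB.instance Definition _ (R : rcfType) := NormedModule.copy R[i] R[i]^o.

Notation "{ 'inner' H }" := {dot H for @Num.conj _} (format "{ 'inner'  H }").

Definition separable (T : topologicalType) :=
  exists2 D : set T, countable D & dense D.

(* A possibly unbounded operator: the values of [opfun] outside [opdom] are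
   irrelevant.  Linearity is not part of the record, see [linear_op]. *)
Record operator (H : Type) := Operator {
  opdom : set H;
  opfun :> H -> H }.

Section Operators.
Variables (R : realType) (H : completeNormedModType R[i]).
Implicit Types (T S : operator H) (B : H -> H).

Definition everywhere B : operator H := Operator setT B.

Definition perturb T B : operator H := Operator (opdom T) (fun u => T u + B u).

Definition linear_op T :=
  opdom T 0 /\ forall (a : R[i]) u v, opdom T u -> opdom T v ->
    opdom T (a *: u + v) /\ T (a *: u + v) = a *: T u + T v.

Definition op_eq T S :=
  opdom T = opdom S /\ forall u, opdom T u -> T u = S u.

(* Inner products are linear in the first argument, antilinear in the second. *)
Variable ip : {inner H}.

(* [w] is unique, hence [adjoint] meaningful, as soon as [opdom T] is dense. *)
Definition adjoint T : operator H :=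
  let A v := [set w | forall u, opdom T u -> ip (T u) v = ip u w] in
  Operator [set v | A v !=set0] (fun v => xget 0 (A v)).

Definition self_adjoint T :=
  [/\ linear_op T, dense (opdom T) & op_eq T (adjoint T)].

(* [F] is the filter along which the limit is taken: [\oo] for a sequence,
   [within I \oo] for a family indexed by an infinite set [I] of naturals. *)
Definition weak_cvg (F : set_system nat) (u : nat -> H) (l : H) :=
  forall v, (fun n => ip (u n) v) @ F --> ip l v.

Definition ess_spectrum T : set R[i] :=
  [set lambda | exists u : nat -> H,
    [/\ forall n, opdom T (u n),
        forall n, `|u n| = 1,
        weak_cvg \oo u 0 &
        (fun n => `|T (u n) - lambda *: u n|) @ \oo --> (0 : R[i])]].

(* The values [u n] for [n] outside [I] play no role. *)
Definition lim_ess_spectrum (T : nat -> operator H) : set R[i] :=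
  [set lambda | exists I : set nat, infinite_set I /\ exists u : nat -> H,
    [/\ forall n, I n -> opdom (T n) (u n),
        forall n, I n -> `|u n| = 1,
        weak_cvg (within I \oo) u 0 &
        (fun n => `|T n (u n) - lambda *: u n|) @ within I \oo
          --> (0 : R[i])]].

(* When [B] is self-adjoint, the values [ip (B u) u] are real. *)
Definition numerical_values B : set (\bar R) :=
  [set (complex.Re (ip (B u) u))%:E | u in [set u | `|u| = 1]].

Definition s_minus (s : nat -> H -> H) : \bar R :=
  limn_einf (fun n => ereal_inf (numerical_values (s n))).

Definition s_plus (s : nat -> H -> H) : \bar R :=
  limn_esup (fun n => ereal_sup (numerical_values (s n))).

End Operators.

Section Adjoint.
Variables (R : realType) (H : completeNormedModType R[i]) (ip : {inner H}).
Hypothesis ip_norm : forall u, ip u u = `|u| ^+ 2.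

Lemma dense_orthogonal (D : set H) (x : H) :
  dense D -> (forall u, D u -> ip u x = 0) -> x = 0.
Proof.
move=> dD Dx; apply/eqP/negPn/negP => x0.
have [|u [xu /Dx ux]] := dD (ball x `|x|) _ (ball_open _ _).
  by exists x; apply: ballxx; rewrite normr_gt0.
move: xu; rewrite -ball_normE /ball_ /= => xu.
have /= := dnormB ip u x; rewrite ux rmorph0 addr0 subr0 !ip_norm distrC => E.
have : `|x - u| ^+ 2 < `|x| ^+ 2 by rewrite ltrXn2r.
by rewrite E gtrDr => /(le_lt_trans (exprn_ge0 2 (normr_ge0 u))); rewrite ltxx.
Qed.

Lemma adjointP (T : operator H) v w : dense (opdom T) ->
  (forall u, opdom T u -> ip (T u) v = ip u w) -> adjoint ip T v = w.
Proof.
move=> dT Tw; rewrite /adjoint /=; set A := [set _ | _].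
have Aw : A w by [].
have Ax := xgetPex 0 (ex_intro A w Aw).
apply/eqP; rewrite -subr_eq0; apply/eqP/(dense_orthogonal dT) => u Du.
rewrite linearBr; apply/eqP; rewrite subr_eq0; apply/eqP.
exact: etrans (esym (Ax u Du)) (Tw u Du).
Qed.

(* For [c = i gamma], the adjoint of [T + i gamma s] is [T - i gamma s]. *)
Lemma adjoint_perturb (T : operator H) (s : H -> H) (c : R[i]) :
  self_adjoint ip T -> self_adjoint ip (everywhere s) ->
  op_eq (adjoint ip (perturb T (fun u => c *: s u)))
        (perturb T (fun u => c^* *: s u)).
Proof.
move=> [_ dT [domT eqT]] [_ ds [doms eqs]].
have sS u v : ip (s u) v = ip u (s v).
  have [w sw] : opdom (adjoint ip (everywhere s)) v by rewrite -doms.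
  have -> : s v = w by apply: etrans (eqs v I) _; exact: adjointP.
  exact: sw.
have TS u v : opdom T u -> opdom T v -> ip (T u) v = ip u (T v).
  move=> Tu Tv; have := Tv; rewrite domT => -[w Tw].
  by rewrite Tw //; congr (ip u _); rewrite (eqT v Tv) (adjointP dT Tw).
have cS u v : ip (c *: s u) v = ip u (c^* *: s v).
  by rewrite linearZl_LR linearZr_LR /= conjCK sS.
have main v : opdom (perturb T (fun u => c *: s u)) v ->
    forall u, opdom T u -> ip (T u + c *: s u) v = ip u (T v + c^* *: s v).
  move=> Tv u Tu; rewrite linearDl linearDr.
  exact: (congr2 +%R (TS u v Tu Tv) (cS u v)).
have domE : opdom (adjoint ip (perturb T (fun u => c *: s u))) = opdom T.
  apply/seteqP; split=> [v [w Tw] | v Tv]; last first.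
    by exists (T v + c^* *: s v) => u; exact: main.
  rewrite domT; exists (w - c^* *: s v) => u Tu.
  rewrite linearBr; apply/eqP; rewrite eq_sym subr_eq; apply/eqP.
  apply: etrans (esym (Tw u Tu)) _; rewrite /= linearDl.
  exact: (congr1 (+%R _) (cS u v)).
split=> // v; rewrite domE => Tv; apply: adjointP => //; exact: main.
Qed.

End Adjoint.

Section Regions.
Variable R : realType.
Implicit Types (gamma x : R) (A : set R[i]).

Definition conj_set A : set R[i] := [set z^* | z in A].

(* Extended-real valued, so that the distance to the empty set is [+oo]. *)
Definition dist x A : \bar R :=
  ereal_inf [set (complex.Re `|x%:C%C - a|)%:E | a in A].

Definition Gamma_a gamma A : set R[i] :=
  [set lambda | 0 <= complex.Im lambda <= gamma /\
    (dist (complex.Re lambda) A <=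
     (Num.sqrt (complex.Im lambda * (gamma - complex.Im lambda)))%:E)%E].

Definition Gamma_b gamma A (sm sp : \bar R) : set R[i] :=
  [set a + 'i%C * (gamma * t)%:C%C | a in A &
    t in [set t : R | (sm <= t%:E <= sp)%E]].

End Regions.

(* Main.v *)
Require Import Defs.
From HB Require Import structures.
From mathcomp Require Import all_boot all_order all_algebra.
From mathcomp Require Import sesquilinear complex.
From mathcomp Require Import all_classical all_reals all_analysis.
From mathcomp Require Import ring lra.

Set Implicit Arguments.
Unset Strict Implicit.
Unset Printing Implicit Defensive.

Import Order.TTheory GRing.Theory Num.Theory.
Import numFieldNormedType.Exports.

Local Open Scope classical_set_scope.
Local Open Scope ring_scope.

(** Write [lambda = a + i b], let [c] be [i] or [-i], and suppose that unit
    vectors [u_n], weakly null, satisfy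
    [(T0 - a) u_n + c (gamma s_n u_n - b u_n) -> 0]; points of the two limiting
    essential spectra of the statement are exactly of this form, by the formula
    for the adjoint of [T_n].  Pairing with [c u_n] kills the self-adjoint part
    and gives [gamma <s_n u_n, u_n> -> b] ([quasimode_expectation]).

    When the [s_n] are projections, [|gamma s_n u_n - b u_n|^2] is an affine
    function of [<s_n u_n, u_n>] and converges to [b (gamma - b)], so
    [|(T0 - a) u_n|] has limit [sqrt (b (gamma - b))].  When the commutators
    vanish asymptotically, so does the cross term in the expansion of the
    square of the norm of the sum of the two parts; each of them then tends to
    zero, so [a] lies in the essential spectrum of [T0], and [b / gamma], being
    a limit of values of the numerical ranges of the [s_n], lies in
    [[s_-, s_+]].

    The first case rests on a fact about one self-adjoint operator [T]
    ([ess_spectrum_near0]): if [|T u_n|^2] is asymptotically at most [d2] along weakly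
    null unit vectors, the essential spectrum contains some [m] with
    [m^2 <= d2].  It is obtained without spectral measures, from the bounded
    positive operator [K = (T^2 + 1)^-1].  Let [M] be the largest asymptotic
    value of [|K u_n|] over weakly null unit sequences.  Convexity gives
    [M >= 1 / (1 + d2)].  A sequence that attains [M] satisfies
    [(K^2 - M^2) u_n -> 0], because [K u_n / |K u_n|] competes for the same
    maximum; as [K] is positive, [(K - M) u_n -> 0].  With [m^2 = 1/M - 1] this
    reads [(T - m) (T + m) K u_n -> 0], so that [m] or [-m] belongs to the
    essential spectrum.  The operator [K] itself comes from projecting [(u, 0)]
    orthogonally onto the graph of [T], as in von Neumann's argument.

    Only real parts of inner products and real scalars occur in these
    arguments, so that [H] is treated as a real Hilbert space. *)

(** * The underlying real inner product space *)

Section RealInner.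
Variables (R : realType) (H : completeNormedModType R[i]) (ip : {inner H}).
Hypothesis ip_norm : forall u : H, ip u u = `|u| ^+ 2.
Implicit Types (u v w : H) (a b e : R).

Definition rip u v : R := complex.Re (ip u v).
Definition rnorm u : R := complex.Re `|u|.
Definition rscale a u : H := a%:C%C *: u.
Local Notation "a *' u" := (rscale a u) (at level 40).

Lemma ReD (x y : R[i]) : complex.Re (x + y) = complex.Re x + complex.Re y.
Proof. by case: x y => [? ?] [? ?]. Qed.

Lemma ReN (x : R[i]) : complex.Re (- x) = - complex.Re x.
Proof. by case: x => [? ?]. Qed.

Lemma ReZ a (x : R[i]) : complex.Re (a%:C%C * x) = a * complex.Re x.
Proof. by case: x => [? ?] /=; rewrite mul0r subr0. Qed.

Lemma ip_conj u v : ip v u = (ip u v)^*%C.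
Proof. by rewrite (hermC ip) /= expr0 mul1r. Qed.

Lemma ripC u v : rip u v = rip v u.
Proof. by rewrite /rip (ip_conj u v); case: (ip u v). Qed.

Lemma ripDl u v w : rip (u + v) w = rip u w + rip v w.
Proof. by rewrite /rip linearDl ReD. Qed.

Lemma ripNl u w : rip (- u) w = - rip u w.
Proof. by rewrite /rip linearNl ReN. Qed.

Lemma ripZl a u w : rip (a *' u) w = a * rip u w.
Proof. by rewrite /rip linearZl_LR ReZ. Qed.

Lemma rip0l w : rip 0 w = 0.
Proof. by rewrite /rip linear0l. Qed.

Lemma ripBl u v w : rip (u - v) w = rip u w - rip v w.
Proof. by rewrite ripDl ripNl. Qed.

Lemma ripDr u v w : rip w (u + v) = rip w u + rip w v.
Proof. by rewrite ripC ripDl !(ripC w). Qed.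

Lemma ripNr u w : rip w (- u) = - rip w u.
Proof. by rewrite ripC ripNl ripC. Qed.

Lemma ripBr u v w : rip w (u - v) = rip w u - rip w v.
Proof. by rewrite ripDr ripNr. Qed.

Lemma ripZr a u w : rip w (a *' u) = a * rip w u.
Proof. by rewrite ripC ripZl ripC. Qed.

Lemma rip0r w : rip w 0 = 0.
Proof. by rewrite ripC rip0l. Qed.

Definition ripE := (ripDl, ripDr, ripBl, ripBr, ripNl, ripNr, ripZl, ripZr).

Lemma normE u : `|u| = (rnorm u)%:C%C.
Proof. by rewrite /rnorm RRe_real // ger0_real. Qed.

Lemma rnorm_ge0 u : 0 <= rnorm u.
Proof. by rewrite -ler0c -normE. Qed.

Lemma rnorm_sq u : rnorm u ^+ 2 = rip u u.
Proof.
by rewrite /rip ip_norm normE -rmorphXn.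
Qed.

Lemma rip_ge0 u : 0 <= rip u u.
Proof. by rewrite -rnorm_sq sqr_ge0. Qed.

Lemma rnorm0 : rnorm 0 = 0.
Proof. by rewrite /rnorm normr0. Qed.

Lemma rnormD u v : rnorm (u + v) <= rnorm u + rnorm v.
Proof. by rewrite -lecR rmorphD /= -!normE ler_normD. Qed.

Lemma rnormN u : rnorm (- u) = rnorm u.
Proof. by rewrite /rnorm normrN. Qed.

Lemma rnorm_eq0 u : (rnorm u == 0) = (u == 0).
Proof. by rewrite -(normr_eq0 u) normE -(inj_eq (@complexI R)). Qed.

Lemma rnormZ (c : R[i]) u : rnorm (c *: u) = complex.Re `|c| * rnorm u.
Proof. by rewrite /rnorm normrZ (normE u) mulrC ReZ mulrC. Qed.

Lemma rnorm_scale a u : rnorm (a *' u) = `|a| * rnorm u.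
Proof.
rewrite rnormZ; congr (_ * _).
by rewrite normc_def /= expr0n /= addr0 sqrtr_sqr.
Qed.

Lemma rip_le u v : `|rip u v| <= rnorm u * rnorm v.
Proof.
have h x y : rip x y <= rnorm x * rnorm y.
  have [/eqP x0|x0] := boolP (rnorm x == 0).
    have /eqP/[!rnorm_eq0]/eqP-> := x0.
    by rewrite rip0l rnorm0 mul0r.
  have [/eqP y0|y0] := boolP (rnorm y == 0).
    have /eqP/[!rnorm_eq0]/eqP-> := y0.
    by rewrite rip0r rnorm0 mulr0.
  have xp : 0 < rnorm x by rewrite lt_def x0 rnorm_ge0.
  have yp : 0 < rnorm y by rewrite lt_def y0 rnorm_ge0.
  have := rip_ge0 (rnorm y *' x - rnorm x *' y).
  rewrite !ripE (ripC y x) -!rnorm_sq => H0.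
  have : 0 <= (rnorm x * rnorm y) * (rnorm x * rnorm y - rip x y) by nra.
  by rewrite pmulr_rge0 ?mulr_gt0// subr_ge0.
rewrite ler_norml h andbT.
by have := h (- u) v; rewrite ripNl rnormN => ?; lra.
Qed.

Lemma rip_eq0 u : (forall v, rip u v = 0) -> u = 0.
Proof. by move=> /(_ u) /eqP; rewrite -rnorm_sq sqrf_eq0 rnorm_eq0 => /eqP. Qed.

Lemma rscale_opp a u : (- a) *' u = - (a *' u).
Proof. by rewrite /rscale rmorphN scaleNr. Qed.

Lemma rscaleN a u : a *' (- u) = - (a *' u).
Proof. by rewrite /rscale scalerN. Qed.

Lemma rscaleA a b u : a *' (b *' u) = (a * b) *' u.
Proof. by rewrite /rscale scalerA -rmorphM. Qed.

Lemma rscaleDr a u v : a *' (u + v) = a *' u + a *' v.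
Proof. by rewrite /rscale scalerDr. Qed.

Lemma rscaleDl a b u : (a + b) *' u = a *' u + b *' u.
Proof. by rewrite /rscale rmorphD scalerDl. Qed.

Lemma Im_ip u v : complex.Im (ip u v) = rip u ('i%C *: v).
Proof.
rewrite /rip linearZr_LR /=; case: (ip u v) => x y /=.
by ring.
Qed.

Lemma cauchy_complete (x : nat -> H) :
  (forall e, 0 < e -> exists N, forall m n, (N <= m)%N -> (N <= n)%N ->
     rnorm (x m - x n) < e) ->
  exists w, forall e, 0 < e -> exists N, forall n, (N <= n)%N ->
    rnorm (x n - w) < e.
Proof.
move=> xC.
have /cauchy_cvgP xc : cauchy (x @ \oo).
  apply/cauchy_ballP => e e0.
  have eE : e = (complex.Re e)%:C%C by rewrite RRe_real ?gtr0_real.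
  have {}e0 : 0 < complex.Re e by rewrite -ltcR -eE.
  have [N NP] := xC _ e0.
  pose tail := [set y | exists2 n, (N <= n)%N & y = x n].
  exists (tail, tail).
    by split; exists N => // n /= Nn; exists n.
  move=> [y z] [/= [m Nm ->] [n Nn ->]]; rewrite -ball_normE /ball_ /=.
  by rewrite eE normE ltcR NP.
exists (lim (x @ \oo)) => e e0.
have : 0 < e%:C%C by rewrite ltcR.
move/cvgr_dist_lt: xc => /[apply] -[N _ NP].
exists N => n Nn; have := NP n Nn; rewrite /= normE ltcR.
by rewrite -rnormN opprB.
Qed.

End RealInner.

(** * The inverse of [T^2 + 1] *)

Section MaxSymmetric.
Variables (R : realType) (H : completeNormedModType R[i]) (ip : {inner H}).
Hypothesis ip_norm : forall u : H, ip u u = `|u| ^+ 2.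
Implicit Types (u v w : H) (a b e : R).
Local Notation rip := (rip ip).
Local Notation "a *' u" := (rscale a u) (at level 40).

(** Self-adjointness as it is used below: the last clause says that the
    adjoint does not properly extend [T], and makes [T] closed.  Being stated with the
    real inner product, it passes to [T - a] for real [a] at once. *)
Definition max_symmetric (T : operator H) :=
  [/\ linear_op T,
      forall u v, opdom T u -> opdom T v -> rip (T u) v = rip u (T v) &
      forall v w, (forall u, opdom T u -> rip (T u) v = rip u w) ->
        opdom T v /\ T v = w].

Lemma rip_cvg (x : nat -> H) w v :
  (forall e, 0 < e -> exists N, forall n, (N <= n)%N -> rnorm (x n - w) < e) ->
  (fun n => rip (x n) v) @ \oo --> rip w v.
Proof.
move=> xw; apply/cvgrPdist_lt => e e0.
have v0 : 0 < rnorm v + 1 by have := rnorm_ge0 v; lra.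
have [N NP] := xw (e / (rnorm v + 1)) (divr_gt0 e0 v0).
exists N => // n /= /NP; rewrite ltr_pdivlMr// => xn.
rewrite distrC -(ripBl ip); apply: le_lt_trans (rip_le ip_norm _ _) _.
by apply: le_lt_trans xn; rewrite ler_wpM2l ?rnorm_ge0//; lra.
Qed.

Variable T : operator H.
Hypothesis Tms : max_symmetric T.
Let D := opdom T.

Lemma ms_dom0 : D 0. Proof. by case: Tms => -[]. Qed.

Lemma ms_lin (c : R[i]) u v : D u -> D v ->
  D (c *: u + v) /\ T (c *: u + v) = c *: T u + T v.
Proof. by case: Tms => -[_ h] _ _; apply: h. Qed.

Lemma ms_D u v : D u -> D v -> D (u + v) /\ T (u + v) = T u + T v.
Proof. by move=> Du Dv; have := ms_lin 1 Du Dv; rewrite !scale1r. Qed.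

Lemma ms_0 : T 0 = 0.
Proof.
have [_] := ms_D ms_dom0 ms_dom0; rewrite addr0 => /eqP.
by rewrite -subr_eq0 opprD addNKr oppr_eq0 => /eqP.
Qed.

Lemma ms_cZ (c : R[i]) u : D u -> D (c *: u) /\ T (c *: u) = c *: T u.
Proof. by move=> Du; have := ms_lin c Du ms_dom0; rewrite ms_0 !addr0. Qed.

Lemma ms_Z a u : D u -> D (a *' u) /\ T (a *' u) = a *' T u.
Proof. exact: ms_cZ. Qed.

Lemma ms_B u v : D u -> D v -> D (u - v) /\ T (u - v) = T u - T v.
Proof.
move=> Du Dv; have [Dv' Tv'] := ms_cZ (-1) Dv.
by have := ms_D Du Dv'; rewrite Tv' !scaleN1r.
Qed.

Lemma ms_sym u v : D u -> D v -> rip (T u) v = rip u (T v).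
Proof. by case: Tms => _ h _; apply: h. Qed.

Lemma ms_max v w : (forall u, D u -> rip (T u) v = rip u w) -> D v /\ T v = w.
Proof. by case: Tms => _ _; apply. Qed.

Let graph_sq u : R := rip u u + rip (T u) (T u).
Let graph_norm u : R := Num.sqrt (graph_sq u).

Let graph_sq_ge0 u : 0 <= graph_sq u.
Proof. by rewrite addr_ge0 ?rip_ge0. Qed.
Let graph_norm_sq u : graph_norm u ^+ 2 = graph_sq u.
Proof. by rewrite sqr_sqrtr. Qed.
Let graph_norm_ge0 u : 0 <= graph_norm u. Proof. exact: sqrtr_ge0. Qed.

Lemma quadratic_bound (g e B : R) : 0 <= g ->
  (forall t : R, 0 <= t ^+ 2 * g + 2 * t * B + e ^+ 2) -> B ^+ 2 <= e ^+ 2 * g.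
Proof.
rewrite le_eqVlt => /predU1P[<- h|g0 h].
  have [->|B0] := eqVneq B 0; first by rewrite mulr0 expr0n.
  have := h (- (e ^+ 2 + 1) / (2 * B)).
  have -> : 2 * (- (e ^+ 2 + 1) / (2 * B)) * B = - (e ^+ 2 + 1) by field.
  by lra.
have := h (- B / g).
have -> : (- B / g) ^+ 2 * g + 2 * (- B / g) * B + e ^+ 2 =
    (e ^+ 2 * g - B ^+ 2) / g.
  by field; rewrite gt_eqF.
by rewrite pmulr_lge0 ?invr_gt0// subr_ge0.
Qed.

(** Almost minimizers over the graph of [T] of the distance to [(u, 0)] are
    almost orthogonal to the graph, since a quadratic polynomial in [t] that is
    nonnegative up to [e^2] has a small linear coefficient. *)
Lemma almost_projection u e : 0 < e -> exists2 p, D p &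
  forall q, D q -> `|rip (p - u) q + rip (T p) (T q)| <= e * graph_norm q.
Proof.
move=> e0; pose J p := rip (p - u) (p - u) + rip (T p) (T p).
have J0 p : 0 <= J p by rewrite addr_ge0 ?rip_ge0.
have hi : has_inf [set J p | p in D].
  split; first by exists (J 0), 0 => //; exact: ms_dom0.
  by exists 0 => _ [p _ <-].
have [_ [p Dp <-] pJ] := inf_adherent (exprn_gt0 2 e0) hi.
exists p => // q Dq.
rewrite -(@ler_pXn2r _ 2) ?nnegrE ?mulr_ge0 ?(ltW e0)//.
rewrite real_normK ?num_real//.
rewrite exprMn graph_norm_sq; apply: quadratic_bound => // t.
have [Dt Tt] := ms_Z t Dq; have [Dpt Tpt] := ms_D Dp Dt.
have : inf [set J p | p in D] <= J (p + t *' q).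
  by apply: ge_inf; [exact: hi.2|exists (p + t *' q)].
move: pJ; rewrite /J /graph_sq Tpt Tt !ripE !(ripC ip q) !(ripC ip u).
rewrite !(ripC ip (T q)).
set a := inf _; set b := rip p p; set c := rip p u; set d := rip p q.
set f := rip q u.
set h := rip (T p) _; set i := rip (T p) _; set j := rip q q; set k := rip (T q) _.
by set l := rip u u; move=> ? ?; nra.
Qed.

(** The orthogonality relation satisfied by the projection [(w, T w)] of
    [(u, 0)] onto the graph says that [T w] belongs to the domain of the
    adjoint, with value [u - w]. *)
Lemma square_resolvent_exists u : exists w, [/\ D w, D (T w) & T (T w) + w = u].
Proof.
have {}ap k : {p | D p & forall q, D q ->
    `|rip (p - u) q + rip (T p) (T q)| <= k.+1%:R^-1 * graph_norm q}.
  by apply: cid2; apply: almost_projection; rewrite invr_gt0.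
pose p k := s2val (ap k); have Dp k : D (p k) := s2valP (ap k).
have pP k q : D q ->
    `|rip (p k - u) q + rip (T (p k)) (T q)| <= k.+1%:R^-1 * graph_norm q.
  exact: (s2valP' (ap k)).
have gC e : 0 < e -> exists N, forall m n, (N <= m)%N -> (N <= n)%N ->
    graph_norm (p m - p n) < e.
  move=> e0; have [N _ NP] := near_infty_natSinv_lt (PosNum (divr_gt0 e0 (ltr0n R 2))).
  exists N => m n Nm Nn.
  have [Dd Td] := ms_B (Dp m) (Dp n).
  have hm : m.+1%:R^-1 < e / 2 := NP _ Nm.
  have hn : n.+1%:R^-1 < e / 2 := NP _ Nn.
  have := pP m _ Dd; have := pP n _ Dd; set d := p m - p n in Dd Td *.
  move=> /ler_normlP[h1 _] /ler_normlP[_ h2].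
  have E : graph_norm d ^+ 2 = rip (p m - u) d + rip (T (p m)) (T d) -
      (rip (p n - u) d + rip (T (p n)) (T d)).
    by rewrite graph_norm_sq /graph_sq {1 3}/d Td !ripE; ring.
  have := graph_norm_ge0 d; rewrite le_eqVlt => /predU1P[<-//|d0].
  have : graph_norm d ^+ 2 <= (m.+1%:R^-1 + n.+1%:R^-1) * graph_norm d.
    by rewrite E mulrDl lerD.
  by rewrite expr2 ler_pM2r// => /le_lt_trans; apply; rewrite [e]splitr ltrD.
have rnorm_graph q : rnorm q <= graph_norm q.
  by rewrite -(@ler_pXn2r _ 2) ?nnegrE ?rnorm_ge0// graph_norm_sq (rnorm_sq ip_norm) lerDl rip_ge0.
have rnormT_graph q : rnorm (T q) <= graph_norm q.
  by rewrite -(@ler_pXn2r _ 2) ?nnegrE ?rnorm_ge0// graph_norm_sq (rnorm_sq ip_norm) lerDr rip_ge0.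
have [w wP] : exists w, forall e, 0 < e -> exists N, forall n, (N <= n)%N ->
    rnorm (p n - w) < e.
  apply: cauchy_complete => e /gC[N NP]; exists N => m n Nm Nn.
  exact: le_lt_trans (rnorm_graph _) (NP m n Nm Nn).
have [z zP] : exists z, forall e, 0 < e -> exists N, forall n, (N <= n)%N ->
    rnorm (T (p n) - z) < e.
  apply: cauchy_complete => e /gC[N NP]; exists N => m n Nm Nn.
  have [_ <-] := ms_B (Dp m) (Dp n).
  exact: le_lt_trans (rnormT_graph _) (NP m n Nm Nn).
have [Dw Tw] : D w /\ T w = z.
  apply: ms_max => q Dq; rewrite (ripC ip) (ripC ip q).
  have h1 := rip_cvg (v := T q) wP.
  have h2 := rip_cvg (v := q) zP.
  rewrite -(cvg_lim (@Rhausdorff R) h1) -(cvg_lim (@Rhausdorff R) h2).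
  suff -> : (fun n => rip (T (p n)) q) = (fun n => rip (p n) (T q)) by [].
  by apply/funext => n; rewrite ms_sym.
have [Dz Tz] : D z /\ T z = u - w.
  apply: ms_max => q Dq.
  have h : (fun n => rip (p n) q - rip u q + rip (T (p n)) (T q)) @ \oo -->
      rip w q - rip u q + rip z (T q).
    apply: cvgD; last exact: (rip_cvg (w := z)).
    by apply: cvgB; [exact: (rip_cvg (w := w))|exact: cvg_cst].
  have h0 : (fun n => rip (p n) q - rip u q + rip (T (p n)) (T q)) @ \oo --> (0 : R).
    apply/norm_cvg0P.
    apply: (@squeeze_cvgr _ _ _ _ (fun=> 0) (fun n => n.+1%:R^-1 * graph_norm q)).
    - near=> n; rewrite normr_ge0/=; have := pP n q Dq.
      by rewrite (ripBl ip).
    - exact: cvg_cst.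
    - rewrite -[X in _ --> X](mul0r (graph_norm q)).
      by apply: cvgM; [exact: cvg_harmonic|exact: cvg_cst].
  have E : rip w q - rip u q + rip z (T q) = 0.
    by rewrite -(cvg_lim (@Rhausdorff R) h) (cvg_lim (@Rhausdorff R) h0).
  by rewrite (ripBr ip) !(ripC ip q) (ripC ip (T q)); lra.
by exists w; rewrite Tw Tz subrK.
Unshelve. all: by end_near.
Qed.

Definition square_resolvent u := sval (cid (square_resolvent_exists u)).
Local Notation K := square_resolvent.

Lemma square_resolventP u : [/\ D (K u), D (T (K u)) & T (T (K u)) + K u = u].
Proof. exact: svalP (cid (square_resolvent_exists u)). Qed.

Lemma square_resolvent_rip u v :
  rip (K u) v = rip (K u) (K v) + rip (T (K u)) (T (K v)).
Proof.
have [Du _ _] := square_resolventP u; have [_ Dv {1}<-] := square_resolventP v.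
by rewrite (ripDr ip) addrC ms_sym.
Qed.

Lemma square_resolvent_sym u v : rip (K u) v = rip u (K v).
Proof.
rewrite (ripC ip u) (square_resolvent_rip u v) (square_resolvent_rip v u).
by rewrite (ripC ip (K v)) (ripC ip (T (K v))).
Qed.

Lemma square_resolvent_ge0 u : 0 <= rip (K u) u.
Proof. by rewrite square_resolvent_rip addr_ge0 ?rip_ge0. Qed.

Lemma square_resolventD u v : K (u + v) = K u + K v.
Proof.
apply/eqP; rewrite -subr_eq0; apply/eqP/(rip_eq0 ip_norm) => w.
by rewrite !ripE !square_resolvent_sym !ripE; ring.
Qed.

Lemma square_resolventZ a u : K (a *' u) = a *' K u.
Proof.
apply/eqP; rewrite -subr_eq0; apply/eqP/(rip_eq0 ip_norm) => w.
by rewrite !ripE !square_resolvent_sym !ripE; ring.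
Qed.

Lemma square_resolvent_le u : rnorm (K u) <= rnorm u.
Proof.
have := square_resolvent_rip u u; rewrite -!(rnorm_sq ip_norm) => h.
have /ler_normlP[_] := rip_le ip_norm (K u) u.
have := sqr_ge0 (rnorm (T (K u))); have := rnorm_ge0 u.
have := rnorm_ge0 (K u); rewrite le_eqVlt => /predU1P[<-//|k0] _ h1 h2.
have : rnorm (K u) * rnorm (K u) <= rnorm (K u) * rnorm u by rewrite -expr2; lra.
by rewrite ler_pM2l.
Qed.

Lemma op_square_resolvent_sym u v : rip (T (K u)) v = rip u (T (K v)).
Proof.
have [Du DTu Eu] := square_resolventP u; have [Dv DTv Ev] := square_resolventP v.
have : rip (T (K u)) (T (T (K v)) + K v) = rip (T (T (K u)) + K u) (T (K v)).
  by rewrite (ripDr ip) (ripDl ip) (ms_sym Du Dv) (ms_sym DTu DTv).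
by rewrite Ev Eu.
Qed.

(** Jensen's inequality for the convex function [1 / (1 + x)] and the
    distribution of [T^2] in the state [u]; here it is the Cauchy-Schwarz inequality for the graph
    inner product of [K u] and [u], which equals [<u, u> = 1]. *)
Lemma square_resolvent_lower u : D u -> rnorm u = 1 ->
  1 <= rnorm (K u) * (1 + rnorm (T u) ^+ 2).
Proof.
move=> Du u1; have [DK DTK EK] := square_resolventP u.
have h1 : 1 = rip (K u) u + rip (T (K u)) (T u).
  by rewrite addrC -(ms_sym DTK Du) -(ripDl ip) EK -(rnorm_sq ip_norm) u1 expr1n.
have h2 := square_resolvent_rip u u.
have /ler_normlP[_ h3] := rip_le ip_norm (K u) u.
pose t := 1 + rnorm (T u) ^+ 2.
have t0 : 0 < t by rewrite ltr_pwDl ?sqr_ge0.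
(* The coefficient [t^-1] is that of the graph projection of [K u] onto [u]. *)
have h4 := rip_ge0 ip_norm (K u - t^-1 *' u).
have h5 := rip_ge0 ip_norm (T (K u) - t^-1 *' T u).
have : 0 <= rip (K u) u - 2 * t^-1 + t^-1 ^+ 2 * t.
  move: (addr_ge0 h4 h5); rewrite !ripE (ripC ip u (K u)) (ripC ip (T u) (T (K u))) h2.
  rewrite -(rnorm_sq ip_norm u) -(rnorm_sq ip_norm (T u)) u1 /t.
  move: h1; rewrite h2; set x := _^-1; set kk := rip _ _; set ll := rip _ _.
  set mm := rip _ _ => hm.
  have -> : mm = 1 - (kk + ll) by lra.
  by move=> h6; apply: le_trans h6 _; rewrite le_eqVlt; apply/orP; left; apply/eqP; ring.
have -> : t^-1 ^+ 2 * t = t^-1 by field; rewrite gt_eqF.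
move=> h6; rewrite -ler_pdivrMr// div1r; move: h3; rewrite u1; lra.
Qed.

End MaxSymmetric.

(** * Weakly null families of unit vectors *)

Section WeaklyNull.
Variables (R : realType) (H : completeNormedModType R[i]) (ip : {inner H}).
Hypothesis ip_norm : forall u : H, ip u u = `|u| ^+ 2.
Implicit Types (u v w : H) (a b e : R) (F : seq H) (Q : set H).
Local Notation rip := (rip ip).
Local Notation "a *' u" := (rscale a u) (at level 40).

(** [Q] contains unit vectors in every weak neighbourhood of [0].  In a separable
    space this is the existence of a weakly null sequence of unit vectors in
    [Q]; no subsequence has to be extracted in this form, and finite unions can
    be split. *)
Definition weakly_null Q := forall F e, 0 < e ->
  exists u, [/\ Q u, rnorm u = 1 & forall v, v \in F -> `|rip u v| < e].

Lemma weakly_null_sub Q Q' : (forall u, rnorm u = 1 -> Q u -> Q' u) ->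
  weakly_null Q -> weakly_null Q'.
Proof.
by move=> QQ' h F e e0; have [u [Qu u1 uF]] := h F e e0; exists u; split=> //; apply: QQ'.
Qed.

Lemma weakly_null_or Q Q' : weakly_null (Q `|` Q') -> weakly_null Q \/ weakly_null Q'.
Proof.
move=> h; apply/or_asboolP; rewrite -[X in is_true X]negbK negb_or.
apply/negP => /andP[/asboolP + /asboolP].
move=> /existsNP[F /existsNP[e /not_implyP[e0 n1]]].
move=> /existsNP[F' /existsNP[e' /not_implyP[e'0 n2]]].
have [|u [[Qu|Qu] u1 uF]] := h (F ++ F') (Num.min e e').
- by rewrite lt_min e0.
- apply: n1; exists u; split=> // v vF.
  by have := uF v; rewrite mem_cat vF lt_min => /(_ isT) /andP[].
- apply: n2; exists u; split=> // v vF.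
  by have := uF v; rewrite mem_cat vF orbT lt_min => /(_ isT) /andP[].
Qed.

(** Symmetric maps are weakly continuous, and normalization preserves weak
    convergence to [0] as long as the norms stay away from [0]. *)
Lemma weakly_null_map (L : H -> H) Q Q' c :
  (forall u v, rip (L u) v = rip u (L v)) -> 0 < c ->
  (forall u, rnorm u = 1 -> Q u -> c <= rnorm (L u) /\ Q' ((rnorm (L u))^-1 *' L u)) ->
  weakly_null Q -> weakly_null Q'.
Proof.
move=> Ls c0 QQ' h F e e0.
have [u [Qu u1 uF]] := h (map L F) (e * c) (mulr_gt0 e0 c0).
have [cL Q'L] := QQ' u u1 Qu; have L0 := lt_le_trans c0 cL.
exists ((rnorm (L u))^-1 *' L u); split=> //.
  by rewrite rnorm_scale gtr0_norm ?invr_gt0// mulVf ?gt_eqF.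
move=> v vF; rewrite (ripZl ip) normrM gtr0_norm ?invr_gt0// mulrC ltr_pdivrMr// Ls.
by apply: lt_le_trans (uF _ (map_f L vF)) _; rewrite ler_pM2l.
Qed.

(** The alternative may depend on [e]; by monotonicity one of the two sides
    holds for arbitrarily small, hence for all, [e]. *)
Lemma weakly_null_choose (Q Q' : R -> set H) :
  (forall e e' u, e <= e' -> Q e u -> Q e' u) ->
  (forall e e' u, e <= e' -> Q' e u -> Q' e' u) ->
  (forall e, 0 < e -> weakly_null (Q e) \/ weakly_null (Q' e)) ->
  (forall e, 0 < e -> weakly_null (Q e)) \/ (forall e, 0 < e -> weakly_null (Q' e)).
Proof.
move=> mQ mQ' h; apply/or_asboolP; rewrite -[X in is_true X]negbK negb_or.
apply/negP => /andP[/asboolP/existsNP[e /not_implyP[e0 n1]]].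
move=> /asboolP/existsNP[e' /not_implyP[e'0 n2]].
have [|hQ|hQ] := h (Num.min e e'); first by rewrite lt_min e0.
- by apply: n1; apply: weakly_null_sub hQ => u _; apply: mQ; rewrite ge_min lexx.
- by apply: n2; apply: weakly_null_sub hQ => u _; apply: mQ'; rewrite ge_min lexx orbT.
Qed.

(** Testing the [k]-th vector against the first [k] points of a dense sequence
    is enough, because the vectors are bounded. *)
Lemma weakly_null_seq (Q : nat -> set H) : separable H ->
  (forall k, weakly_null (Q k)) ->
  exists u : nat -> H, [/\ forall k, Q k (u k), forall k, rnorm (u k) = 1 &
    forall v e, 0 < e -> exists N, forall n, (N <= n)%N -> `|rip (u n) v| < e].
Proof.
move=> [D /pcard_surjP[d dD] denD] h.
have ck k : {u | [/\ Q k u, rnorm u = 1 &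
    forall j, (j < k)%N -> `|rip u (d j)| < k.+1%:R^-1]}.
  apply: cid; have [|u [Qu u1 uF]] := h k [seq d j | j <- iota 0 k] k.+1%:R^-1.
    by rewrite invr_gt0.
  by exists u; split=> // j jk; apply/uF/map_f; rewrite mem_iota.
exists (fun k => sval (ck k)); split=> [k|k|v e e0].
- by case: (svalP (ck k)).
- by case: (svalP (ck k)).
have e20 : 0 < (e / 2)%:C%C by rewrite ltcR divr_gt0.
have [|w [vw Dw]] := denD (ball v (e / 2)%:C%C) _ (ball_open _ _).
  by exists v; exact: ballxx.
move: vw; rewrite -ball_normE /ball_ /= normE ltcR => vw.
have [j _ dj] := dD _ Dw.
have [N _ NP] := near_infty_natSinv_lt (PosNum (divr_gt0 e0 (ltr0n R 2))).
exists (maxn N j.+1) => n; rewrite geq_max => /andP[Nn jn].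
have [_ u1 uF] := svalP (ck n); set u := sval (ck n) in u1 uF *.
have -> : v = (v - w) + w by rewrite subrK.
rewrite (ripDr ip); apply: le_lt_trans (ler_normD _ _) _.
rewrite [e]splitr ltrD//; last first.
  by rewrite -dj; apply: lt_trans (uF j jn) (NP n Nn).
by apply: le_lt_trans (rip_le ip_norm _ _) _; rewrite u1 mul1r.
Qed.

Lemma ess_of_weakly_null (T : operator H) a : separable H ->
  (forall e, 0 < e -> weakly_null [set u | opdom T u /\ rnorm (T u - a *' u) < e]) ->
  ess_spectrum ip T a%:C%C.
Proof.
move=> sepH h.
have [|u [uD u1 uw]] := weakly_null_seq (Q := fun k =>
    [set u | opdom T u /\ rnorm (T u - a *' u) < k.+1%:R^-1]) sepH.
  by move=> k; apply: h; rewrite invr_gt0.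
exists u; split.
- by move=> n; case: (uD n).
- by move=> n; rewrite normE u1.
- move=> v; rewrite linear0l; apply/cvgrPdist_lt => e e0.
  have eE : e = (complex.Re e)%:C%C by rewrite RRe_real ?gtr0_real.
  have {}e0 : 0 < complex.Re e by rewrite -ltcR -eE.
  have e2 : 0 < complex.Re e / 2 by rewrite divr_gt0.
  have [N1 P1] := uw v _ e2; have [N2 P2] := uw ('i%C *: v) _ e2.
  exists (maxn N1 N2) => // n /=; rewrite geq_max => /andP[/P1 h1 /P2 h2].
  rewrite sub0r normrN (complexE (ip (u n) v)) Im_ip -/(rip _ _).
  apply: le_lt_trans (ler_normD _ _) _.
  rewrite normrM !normc_def /= !expr0n /= !expr1n !addr0 !add0r sqrtr1 mul1r.
  by rewrite !sqrtr_sqr eE -rmorphD ltcR [ltRHS]splitr ltrD.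
- apply/cvgrPdist_lt => e e0.
  have eE : e = (complex.Re e)%:C%C by rewrite RRe_real ?gtr0_real.
  have {}e0 : 0 < complex.Re e by rewrite -ltcR -eE.
  have [N _ NP] := near_infty_natSinv_lt (PosNum e0).
  exists N => // n /= Nn; rewrite sub0r normrN normr_id normE eE ltcR.
  by have [_ hn] := uD n; apply: lt_trans hn (NP n Nn).
Qed.

(** * Distance from zero to the essential spectrum *)

Section Key.
Variable T : operator H.
Hypothesis Tms : max_symmetric ip T.
Local Notation D := (opdom T).
Local Notation K := (square_resolvent ip_norm Tms).

(** Here [K] behaves at [u] as if [M] were both its norm and [|K u|], up to
    [eta].  Then [|K^2 u - M^2 u|^2 = |K^2 u|^2 - 2 M^2 |K u|^2 + M^4] is small,
    and [K + M], bounded below by [M], can be divided out. *)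
Lemma square_resolvent_eigen (M eta : R) u :
  0 < M -> M <= 1 -> 0 < eta -> eta <= M -> rnorm u = 1 ->
  M - eta <= rnorm (K u) -> rnorm (K (K u)) <= (M + eta) * rnorm (K u) ->
  M ^+ 2 * rnorm (K u - M *' u) ^+ 2 <= 41 * eta.
Proof.
move=> M0 M1 e0 e1 u1; set x := rnorm (K u); set y := rnorm (K (K u)) => xl yl.
have x0 : 0 <= x by exact: rnorm_ge0.
have y0 : 0 <= y by exact: rnorm_ge0.
have xE : rip (K (K u)) u = x ^+ 2 by rewrite square_resolvent_sym (rnorm_sq ip_norm).
have xM : x <= M + eta.
  have /ler_normlP[_] := rip_le ip_norm (K (K u)) u.
  rewrite xE u1 mulr1 => /le_trans/(_ yl); move: x0; rewrite le_eqVlt.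
  by move=> /predU1P[<-|x0]; [lra|rewrite expr2 ler_pM2r].
have h1 v : M ^+ 2 * rnorm v ^+ 2 <= rnorm (K v + M *' v) ^+ 2.
  have := square_resolvent_ge0 ip_norm Tms v; have := rip_ge0 ip_norm (K v).
  rewrite !(rnorm_sq ip_norm) !ripE (ripC ip v (K v)); set p := rip _ _; set q := rip _ _.
  set r := rip v v; nra.
set v := K u - M *' u.
have vE : K v + M *' v = K (K u) - (M ^+ 2) *' u.
  rewrite /v -rscale_opp !(square_resolventD, square_resolventZ) !rscaleDr !rscaleA mulrN -expr2.
  by rewrite !rscale_opp addrA subrK.
apply: le_trans (h1 v) _; rewrite vE (rnorm_sq ip_norm) !ripE (ripC ip u (K (K u))) xE.
rewrite -!(rnorm_sq ip_norm) -/y u1.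
have yy : y ^+ 2 <= (M + eta) ^+ 2 * x ^+ 2.
  by rewrite -exprMn ler_pXn2r ?nnegrE ?mulr_ge0//; lra.
(* The quantity to bound is at most
   [(x^2 - M^2)^2 + x^2 ((M + eta)^2 - x^2)], whose terms are bounded by
   [9 eta] and [32 eta]. *)
have hx : (x - M) ^+ 2 <= eta ^+ 2 by nra.
have hx2 : (x + M) ^+ 2 <= 9.
  have : 0 <= (3 - (x + M)) * (3 + (x + M)) by rewrite mulr_ge0//; lra.
  by lra.
have hA : (x - M) ^+ 2 * (x + M) ^+ 2 <= eta ^+ 2 * 9 by rewrite ler_pM ?sqr_ge0.
have hB1 : x ^+ 2 <= 4.
  have : 0 <= (2 - x) * (2 + x) by rewrite mulr_ge0//; lra.
  by lra.
have hB2 : (M + eta - x) * (M + eta + x) <= (2 * eta) * 4.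
  by rewrite ler_pM//; lra.
have hB : x ^+ 2 * ((M + eta - x) * (M + eta + x)) <= 4 * ((2 * eta) * 4).
  by rewrite ler_pM ?sqr_ge0// mulr_ge0//; lra.
have he : eta ^+ 2 <= eta by rewrite expr2 ler_piMl//; lra.
lra.
Qed.

Lemma factor_square_resolvent_sym (m : R) u v :
  rip (T (K u) + m *' K u) v = rip u (T (K v) + m *' K v).
Proof. by rewrite !ripE op_square_resolvent_sym square_resolvent_sym. Qed.

Variable d2 : R.
Hypothesis d2_ge0 : 0 <= d2.
Hypothesis T_small : forall e, 0 < e ->
  weakly_null [set u | D u /\ rnorm (T u) ^+ 2 <= d2 + e].

(** [M = sup A] is the norm of [K] modulo compact operators. *)
Let A := [set r | weakly_null [set u | r <= rnorm (K u)]].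
Let M := sup A.

Let A_low e : 0 < e -> A (1 + d2 + e)^-1.
Proof.
move=> e0; have p : 0 < 1 + d2 + e by have := d2_ge0; lra.
apply: weakly_null_sub (T_small e0) => u u1 [Du Tu] /=.
have := square_resolvent_lower ip_norm Tms Du u1 => h.
rewrite -[_^-1]mul1r ler_pdivrMr//; apply: le_trans h _.
by rewrite ler_wpM2l ?rnorm_ge0//; lra.
Qed.

Let A_le1 r : A r -> r <= 1.
Proof.
move=> /(_ [::] 1 ltr01)[u [ru u1 _]]; apply: le_trans ru _.
by rewrite -u1 square_resolvent_le.
Qed.

Let A_sup : has_sup A.
Proof.
by split; [exists (1 + d2 + 1)^-1; apply: A_low|exists 1 => r; exact: A_le1].
Qed.

Let M_le1 : M <= 1.
Proof. by apply: ge_sup => [|r /A_le1//]; case: A_sup. Qed.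

Let M_gt0 : 0 < M.
Proof.
apply: lt_le_trans (sup_ubound A_sup.2 (A_low ltr01)).
by rewrite invr_gt0; have := d2_ge0; lra.
Qed.

Let M_lower : 1 <= M * (1 + d2).
Proof.
apply/ler_addgt0Pr => e e0.
have p : 0 < 1 + d2 + e by have := d2_ge0; lra.
have := sup_ubound A_sup.2 (A_low e0).
rewrite -/M -[_^-1]mul1r ler_pdivrMr// => h; apply: le_trans h _.
have : M * e <= e by rewrite ler_piMl// ltW.
by rewrite (mulrDr M (1 + d2)); lra.
Qed.

(** If [K] stretched [K u] by more than [M + eta] along a weakly null family,
   the vectors [K u / |K u|] would put [M + eta] in [A]. *)
Let maximizing (eta : R) : 0 < eta -> eta < M -> weakly_null
  [set u | M - eta <= rnorm (K u) /\ rnorm (K (K u)) <= (M + eta) * rnorm (K u)].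
Proof.
move=> e0 eM; have [r Ar rM] := sup_adherent e0 A_sup.
have : weakly_null
  ([set u | M - eta <= rnorm (K u) /\ rnorm (K (K u)) <= (M + eta) * rnorm (K u)] `|`
   [set u | M - eta <= rnorm (K u) /\ (M + eta) * rnorm (K u) <= rnorm (K (K u))]).
  apply: weakly_null_sub Ar => u u1 /= ru.
  have Mu : M - eta <= rnorm (K u) by apply: le_trans ru; rewrite ltW.
  by have [h|h] := leP (rnorm (K (K u))) ((M + eta) * rnorm (K u));
    [left|right]; split=> //; rewrite ltW.
move=> /weakly_null_or[//|h]; exfalso.
have : A (M + eta).
  apply: (weakly_null_map (L := K) (c := M - eta)) h.
  - exact: square_resolvent_sym.
  - by rewrite subr_gt0.
  - move=> u u1 [h1 h2]; split=> //=.
    have K0 : 0 < rnorm (K u) by apply: lt_le_trans h1; rewrite subr_gt0.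
    by rewrite square_resolventZ rnorm_scale gtr0_norm ?invr_gt0// mulrC ler_pdivlMr.
by move=> /(sup_ubound A_sup.2); rewrite -/M; lra.
Qed.

Let eigen_sequence (k : R) : 0 < k ->
  weakly_null [set u | M / 2 <= rnorm (K u) /\ rnorm (K u - M *' u) < k].
Proof.
(* Any constant larger than the 41 of [square_resolvent_eigen] would do. *)
move=> k0; pose eta := Num.min (M / 2) (M ^+ 2 * k ^+ 2 / 42).
have e0 : 0 < eta.
  by rewrite lt_min divr_gt0//= divr_gt0// mulr_gt0// exprn_gt0.
have e1 : eta <= M / 2 by rewrite ge_min lexx.
have e2 : eta <= M ^+ 2 * k ^+ 2 / 42 by rewrite ge_min lexx orbT.
have eM : eta < M by have := M_gt0; lra.
apply: weakly_null_sub (maximizing e0 eM) => u u1 [h1 h2]; split; first lra.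
have := square_resolvent_eigen M_gt0 M_le1 e0 (ltW eM) u1 h1 h2 => h3.
rewrite -(@ltr_pXn2r _ 2) ?nnegrE ?rnorm_ge0// ?(ltW k0)//.
rewrite -(ltr_pM2l (exprn_gt0 2 M_gt0)); apply: le_lt_trans h3 _.
have : 0 < M ^+ 2 * k ^+ 2 by rewrite mulr_gt0// exprn_gt0.
by lra.
Qed.

(** With [w = K u] and [m^2 = 1/M - 1], [(T - m) (T + m) w = u - w / M] is
    small.  Either [(T + m) w] is not small, and once normalized it is an
    approximate eigenvector for [m]; or it is small, and [w] is one for [-m]. *)
Lemma ess_spectrum_near0 : exists2 m : R, m ^+ 2 <= d2 &
  forall e, 0 < e -> weakly_null [set u | D u /\ rnorm (T u - m *' u) < e].
Proof.
have m2_ge0 : 0 <= M^-1 - 1 by rewrite subr_ge0 invf_ge1.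
pose m := Num.sqrt (M^-1 - 1).
have m2 : m ^+ 2 = M^-1 - 1 by rewrite sqr_sqrtr.
have md : m ^+ 2 <= d2.
  rewrite m2 lerBlDl -[M^-1]mul1r ler_pdivrMr// mulrC; exact: M_lower.
have step e : 0 < e -> weakly_null [set u | D u /\ rnorm (T u - m *' u) < e] \/
    weakly_null [set u | D u /\ rnorm (T u - (- m) *' u) < e].
  (* [c] separates the two cases: [c / (M / 2) < e] and [(k / M) / c < e]. *)
  move=> e0; pose c := e * M / 4.
  have c0 : 0 < c by rewrite !mulr_gt0 ?invr_gt0.
  pose k := e * M * c / 2.
  have k0 : 0 < k by rewrite !mulr_gt0 ?invr_gt0.
  have : weakly_null ([set u | rnorm (K u - M *' u) < k /\ c <= rnorm (T (K u) + m *' K u)] `|`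
     [set u | M / 2 <= rnorm (K u) /\ rnorm (T (K u) + m *' K u) < c]).
    apply: weakly_null_sub (eigen_sequence k0) => u u1 [h1 h2].
    by have [h|h] := leP c (rnorm (T (K u) + m *' K u)); [left|right].
  move=> /weakly_null_or[h|h]; [left|right].
  - apply: (weakly_null_map (L := fun u => T (K u) + m *' K u) (c := c)) h => //.
      exact: factor_square_resolvent_sym.
    move=> u u1 [h1 h2]; split=> //=.
    have [Du DTu Eu] := square_resolventP ip_norm Tms u.
    set y := T (K u) + m *' K u in h2 *.
    have y0 := lt_le_trans c0 h2.
    have [Dm Tm] := ms_Z Tms m Du.
    have [Dy Ty] := ms_D Tms DTu Dm; rewrite -/y in Dy Ty.
    have [Dr Tr] := ms_Z Tms (rnorm y)^-1 Dy; split=> //.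
    have E : T y - m *' y = - (M^-1 *' (K u - M *' u)).
      apply/eqP; rewrite -subr_eq0; apply/eqP/(rip_eq0 ip_norm) => w.
      have TT : T (T (K u)) = u - K u by rewrite -{2}Eu addrK.
      rewrite Ty Tm TT /y !ripE.
      transitivity ((1 - M^-1 * M) * rip u w + (M^-1 - 1 - m ^+ 2) * rip (K u) w).
        by ring.
      by rewrite m2 mulVf ?gt_eqF// !subrr !mul0r addr0.
    rewrite Tr (_ : _ - _ = (rnorm y)^-1 *' (T y - m *' y)); last first.
      by rewrite rscaleDr rscaleN !rscaleA (mulrC m).
    rewrite E rnorm_scale rnormN rnorm_scale !gtr0_norm ?invr_gt0// mulrC ltr_pdivrMr//.
    rewrite mulrC ltr_pdivrMr//; apply: lt_le_trans h1 _.
    have : e * c <= e * rnorm y by rewrite ler_pM2l.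
    have : 0 < e * M * c by rewrite !mulr_gt0.
    have : M * (e * c) <= M * (e * rnorm y) by rewrite !ler_pM2l.
    by rewrite /k; lra.
  - apply: (weakly_null_map (L := K) (c := M / 2)) h;
      [exact: square_resolvent_sym|by rewrite divr_gt0|].
    move=> u u1 [h1 h2]; split=> //=.
    have [Du _ _] := square_resolventP ip_norm Tms u.
    have M20 : 0 < M / 2 by rewrite divr_gt0.
    have y0 := lt_le_trans M20 h1.
    have [Dr Tr] := ms_Z Tms (rnorm (K u))^-1 Du; split=> //.
    rewrite Tr (_ : _ - _ = (rnorm (K u))^-1 *' (T (K u) + m *' K u)); last first.
      by rewrite rscale_opp opprK rscaleDr !rscaleA (mulrC m).
    rewrite rnorm_scale gtr0_norm ?invr_gt0// mulrC ltr_pdivrMr//.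
    apply: lt_le_trans h2 _.
    have : e * (M / 2) <= e * rnorm (K u) by rewrite ler_pM2l.
    have : 0 < e * M by rewrite mulr_gt0.
    by rewrite /c; lra.
have [||h|h] := weakly_null_choose _ _ step.
- by move=> e e' u ee' [Du h]; split=> //; apply: lt_le_trans ee'.
- by move=> e e' u ee' [Du h]; split=> //; apply: lt_le_trans ee'.
- by exists m.
- by exists (- m); rewrite ?sqrrN.
Qed.

End Key.

End WeaklyNull.

(** * Self-adjoint operators and limits along an infinite set *)

Section Limits.
Variables (R : realType) (H : completeNormedModType R[i]) (ip : {inner H}).
Hypothesis ip_norm : forall u : H, ip u u = `|u| ^+ 2.
Implicit Types (u v w : H) (a b e : R) (T : operator H).
Local Notation rip := (rip ip).
Local Notation "a *' u" := (rscale a u) (at level 40).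

Lemma self_adjoint_ip T : self_adjoint ip T ->
  forall u v, opdom T u -> opdom T v -> ip (T u) v = ip u (T v).
Proof.
move=> [_ dT [domT eqT]] u v Tu Tv; have := Tv; rewrite domT => -[w Tw].
by rewrite Tw //; congr (ip u _); rewrite (eqT v Tv) (adjointP ip_norm dT Tw).
Qed.

(** The complex identity defining the adjoint follows from its real part at
    [u] and at [i u]. *)
Lemma self_adjoint_max T : self_adjoint ip T -> max_symmetric ip T.
Proof.
move=> sT; have [[D0 lT] dT [domT eqT]] := sT; split=> //.
- by move=> u v Du Dv; rewrite /rip (self_adjoint_ip sT).
- move=> v w vw.
  have E u : opdom T u -> ip (T u) v = ip u w.
    move=> Du; rewrite [LHS]complexE [RHS]complexE.
    have [Diu Tiu] := lT 'i%C u 0 Du D0.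
    have [_ T00] := lT (-1) 0 0 D0 D0.
    have T0 : T 0 = 0 by move: T00; rewrite !scaleN1r oppr0 addr0 addNr.
    rewrite T0 !addr0 in Diu Tiu.
    have h1 := vw _ Du; have h2 := vw _ Diu.
    have Rei (z : R[i]) : complex.Re ('i%C * z) = - complex.Im z.
      by rewrite mulrC ReiNIm.
    move: h2; rewrite /rip Tiu !linearZl_LR. rewrite !Rei => /oppr_inj ->.
    by move: h1; rewrite /rip => ->.
  have Dv : opdom T v by rewrite domT; exists w.
  by split=> //; rewrite (eqT v Dv) (adjointP ip_norm dT E).
Qed.

Definition shifted T a := perturb T (fun u => - (a *' u)).

Lemma shifted_max T a : max_symmetric ip T -> max_symmetric ip (shifted T a).
Proof.
move=> mT; split.
- split; first exact: ms_dom0 mT.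
  move=> c u v Du Dv; have [Duv Tuv] := ms_lin mT c Du Dv; split=> //=.
  rewrite Tuv /rscale !scalerDr scalerN opprD !scalerA (mulrC c).
  by rewrite addrACA.
- move=> u v Du Dv /=; rewrite !ripE (ms_sym mT)//.
- move=> v w vw; have [|Dv Tv] := ms_max mT (v := v) (w := w + a *' v).
    move=> u Du; have := vw u Du; rewrite /= !ripE; lra.
  by split=> //=; rewrite Tv addrK.
Qed.

Definition imaginary_unit (c : R[i]) := c = 'i%C \/ c = - 'i%C.

Lemma ripZc c u v : imaginary_unit c -> rip (c *: u) (c *: v) = rip u v.
Proof.
rewrite /rip linearZl_LR linearZr_LR /=; case: (ip u v) => x y.
by case=> -> /=; ring.
Qed.

Lemma rip_imaginary c u v : imaginary_unit c ->
  `|rip u (c *: v)| = `|complex.Im (ip u v)|.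
Proof.
case=> ->; first by rewrite Im_ip.
by rewrite scaleNr (ripNr ip) normrN Im_ip.
Qed.

Lemma rip_imaginary0 c u v : imaginary_unit c -> ip u v = ip v u ->
  rip u (c *: v) = 0.
Proof.
move=> hc huv; apply/eqP; rewrite -normr_eq0 rip_imaginary// normr_eq0.
have : complex.Im (ip v u) = - complex.Im (ip u v).
  by rewrite (ip_conj ip u v); case: (ip u v).
by rewrite huv => ?; apply/eqP; lra.
Qed.

Lemma infinite_unbounded (I : set nat) : infinite_set I ->
  forall N, exists2 n, I n & (N <= n)%N.
Proof.
move=> infI N; apply: contrapT => h; apply: infI.
apply: (@sub_finite_set _ I `I_N); last exact: finite_II.
by move=> n In /=; rewrite ltnNge; apply/negP => Nn; apply: h; exists n.
Qed.

Definition along (I : set nat) (P : nat -> Prop) :=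
  exists N, forall n, (N <= n)%N -> I n -> P n.

Lemma alongI I P Q : along I P -> along I Q -> along I (fun n => P n /\ Q n).
Proof.
move=> [N NP] [N' NP']; exists (maxn N N') => n; rewrite geq_max => /andP[h h'] In.
by split; [exact: NP|exact: NP'].
Qed.

Lemma alongW (I : set nat) (P Q : nat -> Prop) :
  (forall n, I n -> P n -> Q n) -> along I P -> along I Q.
Proof. by move=> PQ [N NP]; exists N => n Nn In; apply: PQ => //; apply: NP. Qed.

Lemma along_ex I P : infinite_set I -> along I P -> exists2 n, I n & P n.
Proof.
by move=> infI [N NP]; have [n In Nn] := infinite_unbounded infI N; exists n => //; apply: NP.
Qed.

Lemma cvg_along (I : set nat) (f : nat -> R[i]) : f @ within I \oo --> (0 : R[i]) ->
  forall e, 0 < e -> along I (fun n => complex.Re `|f n| < e).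
Proof.
move=> /cvgrPdist_lt h e e0; have e0' : 0 < e%:C%C by rewrite ltcR.
have [N _ NP] := h _ e0'; exists N => n Nn In.
have := NP n Nn In; rewrite sub0r normrN => h1.
by rewrite -ltcR RRe_real// ger0_real.
Qed.

Lemma weakly_null_along (I : set nat) (u : nat -> H) (Q : set H) : infinite_set I ->
  (forall n, I n -> rnorm (u n) = 1) ->
  (forall v e, 0 < e -> along I (fun n => `|rip (u n) v| < e)) ->
  along I (fun n => Q (u n)) -> weakly_null ip Q.
Proof.
move=> infI u1 uw uQ F e e0.
have /(alongI uQ)/(along_ex infI)[n In [Qn Fn]] :
    along I (fun n => forall v, v \in F -> `|rip (u n) v| < e).
  elim: F => [|v F IH]; first by exists 0%N.
  apply: alongW (alongI (uw v e e0) IH) => n In [h1 h2] w.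
  by rewrite inE => /predU1P[->//|]; exact: h2.
by exists (u n); split=> //; exact: u1.
Qed.

End Limits.

(** * Approximate eigenvectors of the perturbed operators *)

Section Perturbation.
Variables (R : realType) (H : completeNormedModType R[i]) (ip : {inner H}).
Hypothesis ip_norm : forall u : H, ip u u = `|u| ^+ 2.
Implicit Types (u v w x y : H) (e : R).
Local Notation rip := (rip ip).
Local Notation "a *' u" := (rscale a u) (at level 40).

Variables (T0 : operator H) (s : nat -> H -> H) (gamma : R).
Hypothesis T0_sa : self_adjoint ip T0.
Hypothesis s_sa : forall n, self_adjoint ip (everywhere (s n)).

(** [u] witnesses that [a + i b] is in the limiting essential spectrum of
    [T0 + i gamma s_n] if [c = i], and that [a - i b] is in the one of
    [T0 - i gamma s_n] if [c = -i]. *)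
Definition quasimodes (c : R[i]) a b (I : set nat) (u : nat -> H) :=
  [/\ infinite_set I,
      forall n, I n -> opdom T0 (u n),
      forall n, I n -> rnorm (u n) = 1,
      forall v e, 0 < e -> along I (fun n => `|rip (u n) v| < e) &
      forall e, 0 < e -> along I (fun n =>
        rnorm (shifted T0 a (u n) + c *: (gamma *' s n (u n) - b *' u n)) < e)].

Let T n := perturb T0 (fun u => ('i%C * gamma%:C%C) *: s n u).

Lemma rnorm_unit u : `|u| = 1 -> rnorm u = 1.
Proof. by rewrite normE => -[]. Qed.

Lemma weak_along (I : set nat) (u : nat -> H) :
  weak_cvg ip (within I \oo) u 0 ->
  forall v e, 0 < e -> along I (fun n => `|rip (u n) v| < e).
Proof.
move=> uw v e e0; have := uw v; rewrite linear0l => /cvg_along/(_ e e0).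
apply: alongW => n In; apply: le_lt_trans.
rewrite normc_def /= -(sqrtr_sqr (rip _ _)) ler_wsqrtr// lerDl sqr_ge0//.
Qed.

Lemma lim_quasimodes lambda :
  (lim_ess_spectrum ip T `|`
    conj_set (lim_ess_spectrum ip (fun n => adjoint ip (T n)))) lambda ->
  exists c I (u : nat -> H), imaginary_unit c /\
    quasimodes c (complex.Re lambda) (complex.Im lambda) I u.
Proof.
case.
  move=> [I [infI [u [uD u1 uw uc]]]]; exists 'i%C, I, u; split; first by left.
  split=> //.
  - by move=> n In; apply/rnorm_unit/u1.
  - exact: weak_along.
  - move=> e e0; apply: alongW (cvg_along uc e0) => n In.
    rewrite normr_id -/(rnorm _) /=; congr (rnorm _ < _).
    rewrite {1}(complexE lambda) /rscale scalerBr !scalerA scalerDl opprD -!addrA.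
    by congr (_ + _); rewrite addrCA.
move=> [z [I [infI [u [uD u1 uw uc]]]] <-]; exists (- 'i%C), I, u; split; first by right.
have aE n := adjoint_perturb ip_norm ('i%C * gamma%:C%C) T0_sa (s_sa n).
have {}uD n : I n -> opdom T0 (u n).
  by move=> In; have := uD n In; rewrite (aE n).1.
split=> //.
- by move=> n In; apply/rnorm_unit/u1.
- exact: weak_along.
- move=> e e0; apply: alongW (cvg_along uc e0) => n In.
  rewrite normr_id -/(rnorm _) (aE n).2; last by rewrite (aE n).1; exact: uD.
  congr (rnorm _ < _) => /=.
  rewrite {1}(complexE z) /rscale scalerBr !scalerA scalerDl opprD -!addrA.
  have -> : complex.Re z^* = complex.Re z by case: z {uc}.
  have -> : complex.Im z^* = - complex.Im z by case: z {uc}.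
  congr (_ + _); rewrite addrCA; congr (_ + (_ + _)).
    congr (_ *: _); apply/eqP; rewrite eq_complex /=.
    by apply/andP; split; apply/eqP; ring.
  by rewrite rmorphN mulrNN.
Qed.

Lemma s_ip n u v : ip (s n u) v = ip u (s n v).
Proof. exact: (self_adjoint_ip ip_norm (s_sa n)). Qed.

Lemma rscale_ip r u v : ip (r *' u) v = ip u (r *' v).
Proof.
rewrite /rscale linearZl_LR linearZr_LR; congr (_ * _).
by apply/eqP; rewrite eq_complex /= oppr0 !eqxx.
Qed.

Section Quasimode.
Variables (c : R[i]) (a b : R) (n : nat) (u : H).
Hypotheses (c_im : imaginary_unit c) (Du : opdom T0 u) (u1 : rnorm u = 1).
Let x := shifted T0 a u.
Let y := gamma *' s n u - b *' u.
Let q := rip (s n u) u.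

Lemma rnorm_imaginary v : rnorm (c *: v) = rnorm v.
Proof.
apply/eqP; rewrite -(@eqrXn2 _ 2) ?rnorm_ge0//; apply/eqP.
by rewrite !(rnorm_sq ip_norm) ripZc.
Qed.

(** Pairing with [c u] isolates the second part, since [<(T0 - a) u, u>] is
    real. *)
Lemma quasimode_imaginary_part eta : rnorm (x + c *: y) < eta ->
  `|gamma * q - b| < eta.
Proof.
move=> h.
have -> : gamma * q - b = rip (x + c *: y) (c *: u).
  rewrite (ripDl ip) (ripZc ip _ _ c_im) (rip_imaginary0 c_im); last first.
    have := T0_sa; rewrite /x /shifted /= => sT.
    rewrite linearDl linearDr /= linearNl linearNr /= rscale_ip.
    by rewrite (self_adjoint_ip ip_norm sT).
  by rewrite add0r !ripE -/q -(rnorm_sq ip_norm) u1 expr1n mulr1.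
by apply: le_lt_trans (rip_le ip_norm _ _) _; rewrite rnorm_imaginary u1 mulr1.
Qed.

(** For a projection, [<s u, s u> = <s u, u> = q], hence
    [|gamma s u - b u|^2 = b (gamma - b) + (gamma - 2 b) (gamma q - b)].  The
    factor of [eta] comes from the crude bound
    [1 + b (gamma - b) + |gamma - 2 b|] for the norm of [gamma s u - b u]. *)
Lemma quasimode_projection eta : (forall v, s n (s n v) = s n v) -> 0 < eta -> eta <= 1 ->
  0 <= b * (gamma - b) ->
  rnorm (x + c *: y) < eta ->
  rnorm x ^+ 2 <= b * (gamma - b) + eta * (3 + 2 * (b * (gamma - b)) + 3 * `|gamma - 2 * b|).
Proof.
move=> sP e0 e1 B0 h; have h2 := quasimode_imaginary_part h.
have ssq : rip (s n u) (s n u) = q by rewrite /q -{3}(sP u) /rip -s_ip sP.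
have yE : rnorm y ^+ 2 = b * (gamma - b) + (gamma - 2 * b) * (gamma * q - b).
  rewrite (rnorm_sq ip_norm) /y !ripE ssq (ripC ip u (s n u)) -/q -(rnorm_sq ip_norm) u1.
  by ring.
set B := b * (gamma - b) in B0 yE *; set C := `|gamma - 2 * b|.
have C0 : 0 <= C by apply: normr_ge0.
have y2 : rnorm y ^+ 2 <= B + C * eta.
  rewrite yE lerD2l; apply: le_trans (ler_norm _) _; rewrite normrM ler_wpM2l//.
  exact: ltW.
have Ce : C * eta <= C by rewrite ler_piMr.
have y0 := rnorm_ge0 y.
have y1 : rnorm y <= 1 + B + C.
  have := sqr_ge0 (rnorm y - 1).
  have -> : (rnorm y - 1) ^+ 2 = rnorm y ^+ 2 - 2 * rnorm y + 1 by ring.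
  lra.
have xy : rnorm x <= eta + rnorm y.
  have -> : x = (x + c *: y) + - (c *: y) by rewrite addrK.
  by apply: le_trans (rnormD _ _) _; rewrite rnormN rnorm_imaginary lerD2r ltW.
have x2 : rnorm x ^+ 2 <= (eta + rnorm y) ^+ 2.
  by rewrite ler_pXn2r ?nnegrE ?rnorm_ge0// addr_ge0// ltW.
have ey : eta * rnorm y <= eta * (1 + B + C) by rewrite ler_pM2l.
have ee : eta ^+ 2 <= eta by rewrite expr2 ler_piMl// ltW.
have : (eta + rnorm y) ^+ 2 = eta ^+ 2 + 2 * (eta * rnorm y) + rnorm y ^+ 2 by ring.
by lra.
Qed.

(** Of the cross term [2 <(T0 - a) u, c (gamma s u - b u)>] only
    [2 gamma <T0 u, c s u>] survives, all other products being real before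
    multiplication by [c]; and the latter is, up to sign, the imaginary part
    of [2 gamma <T0 u, s u>]. *)
Lemma quasimode_commutator eta eps : rnorm (x + c *: y) < eta -> 0 <= gamma ->
  `|complex.Im (ip (T0 u) (s n u))| <= eps ->
  rnorm x ^+ 2 <= eta ^+ 2 + 2 * gamma * eps.
Proof.
move=> h g0 hI.
have sqD v w : rnorm (v + c *: w) ^+ 2 = rnorm v ^+ 2 + rnorm w ^+ 2 + 2 * rip v (c *: w).
  by rewrite !(rnorm_sq ip_norm) !ripE (ripC ip (c *: w) v) ripZc//; ring.
have h2 := sqD x y.
have usu : ip u (s n u) = ip (s n u) u by rewrite s_ip.
have cZ r v : c *: (r *' v) = r *' (c *: v).
  by rewrite /rscale !scalerA mulrC.
have xy : rip x (c *: y) = gamma * rip (T0 u) (c *: s n u).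
  rewrite /x /y /= scalerBr !cZ !ripE (rip_imaginary0 c_im usu).
  rewrite (rip_imaginary0 (u := u) (v := u) c_im)//.
  by rewrite (rip_imaginary0 c_im (self_adjoint_ip ip_norm T0_sa Du Du)); ring.
have he : rnorm (x + c *: y) ^+ 2 <= eta ^+ 2.
  by rewrite ler_pXn2r ?nnegrE ?rnorm_ge0 ?ltW// (le_lt_trans (rnorm_ge0 _) h).
have : gamma * `|rip (T0 u) (c *: s n u)| <= gamma * eps.
  by rewrite ler_wpM2l// rip_imaginary.
have := ler_norm (- (gamma * rip (T0 u) (c *: s n u))).
rewrite normrN normrM (ger0_norm g0) => h3 h4.
have := sqr_ge0 (rnorm y); move: h2; rewrite xy => h2 h5.
by lra.
Qed.

End Quasimode.
End Perturbation.

(** * The two inclusions *)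

Section Inclusions.
Variables (R : realType) (H : completeNormedModType R[i]) (ip : {inner H}).
Hypothesis ip_norm : forall u : H, ip u u = `|u| ^+ 2.
Hypothesis H_separable : separable H.
Implicit Types (v w x y : H) (e : R).
Local Notation rip := (rip ip).
Local Notation "a *' u" := (rscale a u) (at level 40).

Variables (T0 : operator H) (s : nat -> H -> H) (gamma : R).
Hypothesis T0_sa : self_adjoint ip T0.
Hypothesis s_sa : forall n, self_adjoint ip (everywhere (s n)).
Hypothesis gamma_gt0 : 0 < gamma.

Lemma ess_shifted a m :
  (forall e, 0 < e -> weakly_null ip
    [set v | opdom (shifted T0 a) v /\ rnorm (shifted T0 a v - m *' v) < e]) ->
  ess_spectrum ip T0 (a + m)%:C%C.
Proof.
move=> h; apply: ess_of_weakly_null => // e e0.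
apply: weakly_null_sub (h e e0) => v _ [Dv].
by rewrite /shifted /= rscaleDl opprD addrA.
Qed.

Variables (c : R[i]) (a b : R) (I : set nat) (u : nat -> H).
Hypothesis c_im : imaginary_unit c.
Hypothesis u_quasi : quasimodes ip T0 s gamma c a b I u.

Lemma quasimode_expectation e : 0 < e ->
  along I (fun n => `|gamma * rip (s n (u n)) (u n) - b| < e).
Proof.
move=> e0; case: u_quasi => _ uD u1 _ /(_ e e0); apply: alongW => n In.
by apply: quasimode_imaginary_part => //; [exact: uD|exact: u1].
Qed.

Lemma projection_inclusion : (forall n v, s n (s n v) = s n v) ->
  0 <= b <= gamma /\
  (dist a (ess_spectrum ip T0) <= (Num.sqrt (b * (gamma - b)))%:E)%E.
Proof.
move=> sP; have [infI uD u1 uw uc] := u_quasi.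
have q01 n : I n -> 0 <= rip (s n (u n)) (u n) <= 1.
  move=> In; have ssq : rip (s n (u n)) (s n (u n)) = rip (s n (u n)) (u n).
    by rewrite -{3}(sP n (u n)) /rip -(s_ip ip_norm s_sa) sP.
  rewrite -ssq rip_ge0//= -(rnorm_sq ip_norm).
  have := rip_le ip_norm (s n (u n)) (u n).
  rewrite -ssq -(rnorm_sq ip_norm) u1// mulr1 ger0_norm ?sqr_ge0//.
  have := rnorm_ge0 (s n (u n)); rewrite le_eqVlt => /predU1P[<- _|h].
    by rewrite expr0n ler01.
  by rewrite expr2 ger_pMl// => h1; rewrite mulr_ile1// ltW.
have b_bounds : 0 <= b <= gamma.
  apply/andP; split.
    rewrite -oppr_le0; apply/ler_addgt0Pr => e e0.
    have [n In] := along_ex infI (quasimode_expectation e0).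
    have /andP[q0 _] := q01 n In; have := mulr_ge0 (ltW gamma_gt0) q0.
    by move=> h /ltr_normlP[h1 h2]; lra.
  apply/ler_addgt0Pr => e e0.
  have [n In] := along_ex infI (quasimode_expectation e0).
  have /andP[_ q1] := q01 n In.
  have : gamma * rip (s n (u n)) (u n) <= gamma by rewrite ger_pMr.
  by move=> h /ltr_normlP[h1 h2]; lra.
split=> //; have /andP[b0 bg] := b_bounds.
have B0 : 0 <= b * (gamma - b) by rewrite mulr_ge0// subr_ge0.
pose L := 3 + 2 * (b * (gamma - b)) + 3 * `|gamma - 2 * b|.
have L0 : 0 < L.
  by have := normr_ge0 (gamma - 2 * b); rewrite /L; move: B0; set B := b * _; lra.
have mS := shifted_max a (self_adjoint_max ip_norm T0_sa).
have [|m m2 hm] := ess_spectrum_near0 ip_norm mS B0.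
  move=> e e0; pose eta := Num.min 1 (e / L).
  have eta0 : 0 < eta by rewrite lt_min ltr01 divr_gt0.
  have eta1 : eta <= 1 by rewrite ge_min lexx.
  have etaL : eta * L <= e by rewrite -ler_pdivlMr// ge_min lexx orbT.
  apply: (weakly_null_along infI u1 uw); apply: alongW (uc _ eta0) => n In h.
  split; first exact: uD.
  have := quasimode_projection ip_norm T0_sa s_sa c_im (uD n In) (u1 n In) (sP n)
    eta0 eta1 B0 h.
  by move=> /le_trans; apply; rewrite lerD2l.
apply: (@le_trans _ _ (`|m|)%:E); last first.
  by rewrite lee_fin -sqrtr_sqr ler_wsqrtr.
apply: ereal_inf_lbound; exists (a + m)%:C%C; first exact: ess_shifted.
rewrite -rmorphB opprD addNKr.
by rewrite normc_def /= expr0n /= addr0 sqrrN sqrtr_sqr.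
Qed.

(** The hypothesis concerns full bounded sequences, so the vectors [u_n] are
    replaced by [0] outside [I] and for the first few indices, where
    [T0 u_n] may be large. *)
Lemma commutator_ess :
  (forall v : nat -> H, (forall n, opdom T0 (v n)) ->
      bounded_fun v -> bounded_fun (fun n => T0 (v n)) ->
      (fun n => ip (s n (v n)) (T0 (v n)) - ip (T0 (v n)) (s n (v n)))
        @ \oo --> (0 : R[i])) ->
  (exists2 C : R, 0 <= C & forall n v, rnorm (s n v) <= C * rnorm v) ->
  ess_spectrum ip T0 a%:C%C.
Proof.
move=> comm [C C0 sC]; have [infI uD u1 uw uc] := u_quasi.
have [N0 N0P] := uc 1 ltr01.
pose v n := if (N0 <= n)%N && `[< I n >] then u n else 0.
have mT := self_adjoint_max ip_norm T0_sa.
have bound (f : nat -> H) B : (forall n, rnorm (f n) <= B) -> bounded_fun f.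
  move=> fB; exists B%:C%C; split; first by rewrite complex_real.
  move=> z Bz n _ /=; apply: le_trans (ltW Bz).
  by rewrite normE lecR.
have vD n : opdom T0 (v n).
  rewrite /v; case: ifP => [/andP[_ /asboolP In]|_]; [exact: uD|exact: ms_dom0 mT].
have vb : bounded_fun v.
  apply: (bound _ 1) => n; rewrite /v; case: ifP => [/andP[_ /asboolP In]|_].
    by rewrite u1.
  by rewrite rnorm0.
have Tvb : bounded_fun (fun n => T0 (v n)).
  apply: (bound _ (1 + `|a| + (gamma * C + `|b|))) => n; rewrite /v.
  have g0 := ltW gamma_gt0; case: ifP => [/andP[Nn /asboolP In]|_]; last first.
    by rewrite (ms_0 mT) rnorm0 !addr_ge0// mulr_ge0.
  have cy : rnorm (c *: (gamma *' s n (u n) - b *' u n)) <= gamma * C + `|b|.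
    rewrite (rnorm_imaginary ip_norm c_im); apply: le_trans (rnormD _ _) _.
    rewrite rnormN !rnorm_scale u1// mulr1 lerD2r (ger0_norm g0) ler_wpM2l//.
    by apply: le_trans (sC _ _) _; rewrite u1// mulr1.
  have -> : T0 (u n) = shifted T0 a (u n) + c *: (gamma *' s n (u n) - b *' u n)
      + a *' u n - c *: (gamma *' s n (u n) - b *' u n).
    by rewrite [_ + a *' _]addrAC addrK /shifted /= subrK.
  apply: le_trans (rnormD _ _) _; rewrite rnormN lerD//.
  apply: le_trans (rnormD _ _) _; rewrite rnorm_scale u1// mulr1 lerD2r.
  exact: ltW (N0P n Nn In).
have := comm v vD vb Tvb => /cvgrPdist_lt hc.
apply: ess_of_weakly_null => // e e0.
(* With this choice, [(e / 2)^2 + 2 gamma eps = 3/4 e^2]. *)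
pose eps := e ^+ 2 / (4 * gamma).
have eps0 : 0 < eps by rewrite divr_gt0 ?exprn_gt0// mulr_gt0.
have eps0' : 0 < eps%:C%C by rewrite ltcR.
have [N1 _ N1P] := hc _ eps0'.
apply: (weakly_null_along infI u1 uw).
have hN : along I (fun n => (maxn N0 N1 <= n)%N) by exists (maxn N0 N1).
have e20 : 0 < e / 2 by rewrite divr_gt0.
apply: alongW (alongI hN (uc _ e20)) => n In [+ h].
rewrite geq_max => /andP[Nn0 /N1P /=].
rewrite /v Nn0 asboolT//= sub0r normrN => hI; split; first exact: uD.
have Ie : `|complex.Im (ip (T0 (u n)) (s n (u n)))| <= eps.
  apply/ltW; rewrite -ltcR; apply: le_lt_trans hI.
  rewrite (ip_conj ip (T0 (u n)) (s n (u n))); case: (ip (T0 (u n)) _) => p r /=.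
  rewrite normc_def /= lecR subrr expr0n add0r sqrtr_sqr.
  rewrite (_ : - r - r = - (2 * r)); last by ring.
  by rewrite normrN normrM ger0_norm// ler_peMl// ler1n.
have := quasimode_commutator ip_norm T0_sa s_sa c_im (uD n In) h (ltW gamma_gt0) Ie.
have -> : (e / 2) ^+ 2 + 2 * gamma * eps = 3 / 4 * e ^+ 2.
  by rewrite /eps; field; rewrite gt_eqF.
move=> h3; rewrite -(@ltr_pXn2r _ 2) ?nnegrE ?rnorm_ge0// ?(ltW e0)//.
by apply: le_lt_trans h3 _; have := exprn_gt0 2 e0; lra.
Qed.

Lemma numerical_inclusion :
  (s_minus ip s <= (b / gamma)%:E <= s_plus ip s)%E.
Proof.
have [infI uD u1 uw uc] := u_quasi.
have mem n : I n -> numerical_values ip (s n) (rip (s n (u n)) (u n))%:E.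
  by move=> In; exists (u n) => //=; rewrite normE u1.
have near e m : 0 < e -> exists n, [/\ (m <= n)%N, I n &
    `|rip (s n (u n)) (u n) - b / gamma| < e].
  move=> e0; have ge0 : 0 < gamma * e by rewrite mulr_gt0.
  have hm : along I (fun n => (m <= n)%N) by exists m.
  have [n In [h1 h2]] := along_ex infI (alongI (quasimode_expectation ge0) hm).
  exists n; split=> //; rewrite -(ltr_pM2l gamma_gt0) -{1}(gtr0_norm gamma_gt0) -normrM.
  by rewrite mulrBr mulrCA divff ?gt_eqF// mulr1.
apply/andP; split.
  rewrite /s_minus limn_einf_lim; apply/lee_addgt0Pr => e e0.
  apply: lime_le; first exact: is_cvg_einfs.
  apply: nearW => m; have [n [mn In /ltr_normlP[_ h]]] := near e m e0.
  apply: (@le_trans _ _ (ereal_inf (numerical_values ip (s n)))).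
    by apply: ereal_inf_lbound; exists n.
  apply: le_trans (ereal_inf_lbound (mem n In)) _.
  by rewrite -EFinD lee_fin; lra.
rewrite /s_plus limn_esup_lim; apply/lee_subgt0Pr => e e0.
apply: lime_ge; first exact: is_cvg_esups.
apply: nearW => m; have [n [mn In /ltr_normlP[h _]]] := near e m e0.
apply: (@le_trans _ _ (ereal_sup (numerical_values ip (s n)))); last first.
  by apply: ereal_sup_ubound; exists n.
apply: le_trans (ereal_sup_ubound (mem n In)).
by rewrite -EFinB lee_fin; lra.
Qed.

End Inclusions.

Theorem theorem2p11 (R : realType) (H : completeNormedModType R[i])
    (ip : {inner H}) (ip_norm : forall u : H, ip u u = `|u| ^+ 2)
    (H_separable : separable H)
    (T0 : operator H) (T0_self_adjoint : self_adjoint ip T0)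
    (s : nat -> H -> H)
    (s_self_adjoint : forall n, self_adjoint ip (everywhere (s n)))
    (s_cvg : forall u : H, (fun n => s n u) @ \oo --> u)
    (C : R) (C_gt0 : 0 < C)
    (s_bounded : forall n (u : H), `|s n u| <= C%:C%C * `|u|)
    (gamma : R) (gamma_gt0 : 0 < gamma) :
  let T n := perturb T0 (fun u => ('i%C * gamma%:C%C) *: s n u) in
  let Tstar n := adjoint ip (T n) in
  ((forall n u, s n (s n u) = s n u) ->
    lim_ess_spectrum ip T `|` conj_set (lim_ess_spectrum ip Tstar)
      `<=` Gamma_a gamma (ess_spectrum ip T0)) /\
  ((forall u : nat -> H, (forall n, opdom T0 (u n)) ->
      bounded_fun u -> bounded_fun (fun n => T0 (u n)) ->
      (fun n => ip (s n (u n)) (T0 (u n)) - ip (T0 (u n)) (s n (u n)))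
        @ \oo --> (0 : R[i])) ->
    lim_ess_spectrum ip T `|` conj_set (lim_ess_spectrum ip Tstar)
      `<=` Gamma_b gamma (ess_spectrum ip T0) (s_minus ip s) (s_plus ip s)).
Proof.
move=> T Tstar; split=> hyp lambda
  /(lim_quasimodes ip_norm T0_self_adjoint s_self_adjoint)[c [I [u [c_im qu]]]].
- exact: projection_inclusion c_im qu hyp.
- have sC : exists2 C : R, 0 <= C & forall n v, rnorm (s n v) <= C * rnorm v.
    by exists C => [|n v]; [exact: ltW|]; rewrite -lecR rmorphM /= -!normE.
  exists (complex.Re lambda)%:C%C.
    exact: (commutator_ess ip_norm H_separable T0_self_adjoint s_self_adjoint
      gamma_gt0 c_im qu hyp sC).
  exists (complex.Im lambda / gamma).
    exact: (numerical_inclusion ip_norm T0_self_adjoint gamma_gt0 c_im qu).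
  by rewrite (mulrC gamma) divfK ?gt_eqF// -complexE.
Qed.
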